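(* For every $\gamma > 0$ and finite set $J$, there exists $\epsilon > 0$ such that the following holds. Let $V = V^{(N)} = (J, (V_j)_{j \in J}, r, H)$ be a family of hypergraph systems and let $\nu = \nu^{(N)}$ be weighted hypergraphs on $V^{(N)}$ satisfying the $H$-linear forms condition with rate $\tau$. Then there is $N_0$, depending only on $\gamma$, $J$ and $\tau$, such that for every $N \geq N_0$ and all weighted hypergraphs $g, \tilde g$ on $V = V^{(N)}$ such that $0 \leq g \leq \nu$, $0 \leq \tilde g \leq 1$, and $(g, \tilde g)$ is an $\epsilon$-discrepancy pair, one has $$\Bigl| \mathbb{E}\Bigl[\prod_{e \in H} g_e(x_e) \Big| x \in V_J \Bigr] - \mathbb{E}\Bigl[\prod_{e \in H} \tilde g_e(x_e) \Big| x \in V_J \Bigr] \Bigr| \leq \gamma.$$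
   Context: A hypergraph system is a quadruple $V = (J, (V_j)_{j\in J}, r, H)$, where $J$ is a finite set, the $V_j$ are finite non-empty sets, $r \geq 1$ is an integer, and $H \subseteq \binom{J}{r} := \{e \subseteq J : |e| = r\}$. For $e \subseteq J$ put $V_e := \prod_{j \in e} V_j$; for $x = (x_j)_{j\in J} \in V_J$ and $J' \subseteq J$ put $x_{J'} := (x_j)_{j \in J'} \in V_{J'}$; and put $\partial e := \{ f \subsetneq e : |f| = |e|-1\}$. A weighted hypergraph on $V$ is a collection $g = (g_e)_{e \in H}$ of functions $g_e : V_e \to \mathbb{R}_{\geq 0}$; $0$ and $1$ denote the weighted hypergraphs of constant weight $0$ and $1$, and $g \leq \nu$ means $g_e(x_e) \leq \nu_e(x_e)$ for all $e \in H$ and $x_e \in V_e$. $\mathbb{E}[\,\cdot \mid \cdots]$ is the average over the indicated variables, chosen uniformly and independently. Linear forms condition: let $J, r, H$ be fixed and let $V = V^{(N)} = (J, (V_j^{(N)})_{j \in J}, r, H)$ be hypergraph systems with weighted hypergraphs $\nu = \nu^{(N)}$. For $\omega \in \{0,1\}^e$ write $x_e^{(\omega)} := (x_j^{(\omega_j)})_{j \in e}$. The family $\nu$ satisfies the $H$-linear forms condition with rate $\tau$, where $\tau(N) \to 0$ as $N \to \infty$, if for every choice of exponents $n_{e,\omega} \in \{0,1\}$ and every $N$, $$\Bigl| \mathbb{E}\Bigl[\prod_{e \in H} \prod_{\omega \in \{0,1\}^e} \nu_e(x_e^{(\omega)})^{n_{e,\omega}} \Big| x_J^{(0)}, x_J^{(1)}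 \in V_J \Bigr] - 1 \Bigr| \leq \tau(N).$$ In other words each such expectation is $1+o(1)$, and $\tau$ bounds the $o(1)$ term. Discrepancy pair: $(g, \tilde g)$ is an $\epsilon$-discrepancy pair if for every $e \in H$ and all subsets $B_f \subseteq V_f$, $f \in \partial e$, $$\Bigl| \mathbb{E}\Bigl[ (g_e(x_e) - \tilde g_e(x_e)) \prod_{f \in \partial e} 1_{B_f}(x_f) \Big| x_e \in V_e \Bigr] \Bigr| \leq \epsilon.$$ *)

(* Defs.v *)
From HB Require Import structures.
From mathcomp Require Import all_boot all_order all_algebra.
From mathcomp Require Import reals.
Import Order.TTheory GRing.Theory Num.Theory.

Set Implicit Arguments.
Unset Strict Implicit.
Unset Printing Implicit Defensive.

Local Open Scope ring_scope.

Definition expect (R : realType) (T : finType) (F : T -> R) : R :=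
  (\sum_(x : T) F x) / #|T|%:R.

Section HypergraphSystem.
Variables (J : finType) (V : J -> finType).
Implicit Types e f : {set J}.

Definition elt e : finType := {j : J | j \in e}.

Definition VJ : finType := {dffun forall j : J, V j}.

Definition Vset e : finType := {dffun forall j : elt e, V (val j)}.

Definition restrJ e (x : VJ) : Vset e := [ffun j : elt e => x (val j)].

Definition widen_elt f e (sfe : f \subset e) (j : elt f) : elt e :=
  exist _ (val j) (subsetP sfe (val j) (valP j)).

Definition restr f e (sfe : f \subset e) (x : Vset e) : Vset f :=
  [ffun j : elt f => x (widen_elt sfe j)].

Definition bdry e : {set {set J}} :=
  [set f : {set J} | (f \proper e) && (#|f| == #|e|.-1)].

Lemma bdry_subset e (f : {f : {set J} | f \in bdry e}) : val f \subset e.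
Proof. by have := valP f; rewrite inE => /andP[/proper_sub]. Qed.

(* x_e^(omega); [true] and [false] stand for the superscripts 1 and 0. *)
Definition mixed e (x0 x1 : VJ) (omega : {ffun elt e -> bool}) : Vset e :=
  [ffun j : elt e => if omega j then x1 (val j) else x0 (val j)].

End HypergraphSystem.

(* A family (g_e) indexed by all e; only the g_e with e \in H are relevant,
   and every definition below constrains or reads only those. *)
Definition weights (R : realType) (J : finType) (V : J -> finType) : Type :=
  forall e : {set J}, Vset V e -> R.

Section WeightedHypergraphs.
Variables (R : realType) (J : finType) (V : J -> finType) (H : {set {set J}}).
Implicit Types g nu : weights R V.

Definition const_weights (c : R) : weights R V := fun e _ => c.

Definition le_weights g nu : Prop :=
  forall e, e \in H -> forall x : Vset V e, g e x <= nu e x.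

Definition weighted_hypergraph g : Prop := le_weights (const_weights 0) g.

Definition hom_density g : R :=
  expect (fun x : VJ V => \prod_(e in H) g e (restrJ e x)).

Definition linear_form nu (n : forall e, {ffun elt e -> bool} -> bool) : R :=
  expect (fun x : VJ V * VJ V =>
    \prod_(e in H) \prod_(omega : {ffun elt e -> bool})
      nu e (mixed x.1 x.2 omega) ^+ n e omega).

Definition discrepancy_pair (eps : R) g g' : Prop :=
  forall e, e \in H -> forall B : forall f : {set J}, {set Vset V f},
    `| expect (fun x : Vset V e =>
         (g e x - g' e x) *
         \prod_(f : {f : {set J} | f \in bdry e})
           (restr (bdry_subset f) x \in B (val f))%:R) | <= eps.

End WeightedHypergraphs.

Definition linear_forms_condition (R : realType) (J : finType)
    (H : {set {set J}}) (tau : nat -> R) (V : nat -> J -> finType)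
    (nu : forall N, weights R (V N)) : Prop :=
  forall (n : forall e : {set J}, {ffun elt e -> bool} -> bool) (N : nat),
    `| linear_form H (nu N) n - 1 | <= tau N.

(* Main.v *)
Require Import Defs.
From mathcomp Require Import all_boot all_order all_algebra.
From mathcomp Require Import reals topology normedtype sequences.
From mathcomp Require Import ring lra.
Import Order.TTheory GRing.Theory Num.Theory numFieldNormedType.Exports.

Set Implicit Arguments.
Unset Strict Implicit.
Unset Printing Implicit Defensive.

Local Open Scope classical_set_scope.
Local Open Scope ring_scope.

(** The proof densifies the weights, one edge at a time.

    A function on [V_e] is regarded as a function on the whole product space that
    depends only on the coordinates in [e].  The point [mix A x y] takes its
    coordinates in [A] from [y] and the others from [x]; it is uniformly
    distributed when [x] and [y] are ([expect_mix]), and conditional expectations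
    and doublings of variables are all expressed through it.

    If all functions are bounded by [1], exchanging [g_e] for [g'_e] at one edge
    changes the density by at most [eps]: once the coordinates outside [e] are
    frozen, the remaining factors are [0,1]-valued functions on facets of [e],
    and discrepancy tests against sets extend to such functions because a
    linear functional on a cube is extremal at vertices
    ([discrepancy_pair_low], [dense_counting]).

    In general, let [e1] be an edge with weight [nu], and let [p] and [q] be the
    averages, given [x_e1], of the products of the [g_e] and of the [g'_e] over
    the other edges.  Then
      E[g_e1 p] - E[g'_e1 q] = E[g_e1 (p - q)] + E[(g_e1 - g'_e1) q].
    The last term is bounded by discrepancy.  By Cauchy-Schwarz the square of the
    other is at most [E[nu] * E[nu (p - q)^2]], and the strong linear forms
    property ([strong_linear_forms]) lets [nu] be replaced by [1].  That property
    is itself proved by applying Cauchy-Schwarz in each coordinate of [e1], which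
    replaces all other functions by their majorants and leaves an alternating sum
    of linear forms.

    It remains to bound [E[(p - q)^2]].  As [p] is majorized by a function close
    to [1] in mean square, one factor [p] may be truncated to [min p 1].  What is
    left is [E[u (p - q)]] for two [0,1]-valued functions [u] of [x_e1], namely
    [min p 1] and [q].  This is the difference of two densities having the same
    function [u] at [e1], so that [e1] no longer carries a weight, and induction
    on the number of weighted edges applies ([densification],
    [relative_counting]). *)

(** * Averages over a finite type *)

Section Expect.
Variables (R : realType) (T : finType).
Implicit Types (F G w : T -> R).

Lemma eq_expect F G : F =1 G -> expect F = expect G.
Proof. by move=> eFG; rewrite /expect; under eq_bigr do rewrite eFG. Qed.

Lemma expectD F G : expect (fun x => F x + G x) = expect F + expect G.
Proof. by rewrite /expect big_split mulrDl. Qed.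

Lemma expectZ c F : expect (fun x => c * F x) = c * expect F.
Proof. by rewrite /expect -mulr_sumr mulrA. Qed.

Lemma expectB F G : expect (fun x => F x - G x) = expect F - expect G.
Proof. by rewrite /expect sumrB mulrBl. Qed.

Lemma expect_cst (x0 : T) c : expect (fun _ : T => c) = c :> R.
Proof.
rewrite /expect sumr_const -[c *+ _]mulr_natr mulfK // pnatr_eq0 -lt0n.
by apply/card_gt0P; exists x0.
Qed.

Lemma ler_expect F G : (forall x, F x <= G x) -> expect F <= expect G.
Proof.
by move=> leFG; rewrite ler_wpM2r ?invr_ge0 ?ler0n//; apply: ler_sum.
Qed.

Lemma expect_ge0 F : (forall x, 0 <= F x) -> 0 <= expect F.
Proof. by move=> F0; rewrite divr_ge0 ?ler0n// sumr_ge0. Qed.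

Lemma ler_norm_expect F : `|expect F| <= expect (fun x => `|F x|).
Proof.
rewrite /expect normrM [`|_^-1|]ger0_norm ?invr_ge0 ?ler0n//.
by rewrite ler_wpM2r ?invr_ge0 ?ler0n// ler_norm_sum.
Qed.

Lemma le_expect_cst (x0 : T) F c :
  (forall x, `|F x| <= c) -> `|expect F| <= c.
Proof.
move=> Fc; rewrite (le_trans (ler_norm_expect _))//.
by rewrite -[leRHS](expect_cst x0); apply: ler_expect.
Qed.

(** The quadratic form [E w (s F - t)^2] in [s] and [t] is nonnegative; it is
    evaluated at its minimum [(s, t) = (E w, E (w F))]. *)
Lemma cauchy_schwarz_expect w F : (forall x, 0 <= w x) ->
  expect (fun x => w x * F x) ^+ 2
    <= expect w * expect (fun x => w x * F x ^+ 2).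
Proof.
move=> w0; set a := expect w; set b := expect _; set c := expect _.
have key s t : 0 <= s ^+ 2 * c - 2 * s * t * b + t ^+ 2 * a.
  have -> : s ^+ 2 * c - 2 * s * t * b + t ^+ 2 * a =
      expect (fun x => w x * (s * F x - t) ^+ 2).
    rewrite /a /b /c -!expectZ -expectB -expectD.
    by apply: eq_expect => x; ring.
  by apply: expect_ge0 => x; rewrite mulr_ge0 ?sqr_ge0.
have a0 : 0 <= a by apply: expect_ge0.
have c0 : 0 <= c by apply: expect_ge0 => x; rewrite mulr_ge0 ?sqr_ge0.
have [a_gt0|] := ltrP 0 a; last first.
  move=> a_le0; have {}a0 : a = 0 by apply/eqP; rewrite eq_le a_le0.
  rewrite a0 mul0r.
  (* If [E w = 0], the form is linear in [t], so that [b] must vanish. *)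
  have := key b (c + 1); rewrite a0 mulr0 addr0 => k.
  have {k} : 0 <= - ((c + 2) * b ^+ 2) by rewrite (le_trans k)//; lra.
  by rewrite oppr_ge0 pmulr_rle0// ltr_wpDl.
have := key a b.
have -> : a ^+ 2 * c - 2 * a * b * b + b ^+ 2 * a = a * (a * c - b ^+ 2) by ring.
by rewrite pmulr_rge0// subr_ge0.
Qed.

End Expect.

Lemma exchange_expect (R : realType) (S T : finType) (F : S -> T -> R) :
  expect (fun x => expect (F x)) = expect (fun y => expect (F^~ y)).
Proof.
rewrite /expect -!mulr_suml exchange_big /=.
by rewrite mulrAC.
Qed.

Lemma expect_pair (R : realType) (S T : finType) (F : S * T -> R) :
  expect F = expect (fun x => expect (fun y => F (x, y))).
Proof.
rewrite /expect -mulr_suml pair_big /= card_prod natrM invfM [_^-1 * _]mulrC mulrA.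
by congr (_ * _ * _); apply: eq_bigr => -[].
Qed.

(** * Points of the product space and their coordinates *)

Section Mix.
Variables (R : realType) (J : finType) (V : J -> finType).
Notation X := (VJ V).
Implicit Types (x y z t : X) (A B D e : {set J}) (F G : X -> R).

Definition mix A x y : X := [ffun j => if j \in A then y j else x j].

Lemma mixE A x y j : mix A x y j = if j \in A then y j else x j.
Proof. by rewrite ffunE. Qed.

(** The map [(x, y) |-> (mix A x y, mix A y x)] is an involution, so [mix A x y]
    is uniformly distributed when [x] and [y] are: this one identity replaces
    every appeal to Fubini's theorem for partial sets of coordinates. *)
Lemma expect_mix A F :
  expect (fun x => expect (fun y => F (mix A x y))) = expect F.
Proof.
rewrite -(expect_pair (fun p => F (mix A p.1 p.2))).
pose sw (p : X * X) := (mix A p.1 p.2, mix A p.2 p.1).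
have swK : involutive sw.
  move=> [x y]; rewrite /sw /=; congr (_, _); apply/ffunP => j; rewrite !mixE;
    by case: (j \in A).
have -> : expect (fun p => F (mix A p.1 p.2)) = expect (fun p : X * X => F p.1).
  rewrite /expect; congr (_ / _).
  by rewrite [RHS](reindex_inj (inv_inj swK)).
have [x0 _|noX] := pickP (@predT X); last first.
  by rewrite /expect !big_pred0 ?mul0r // => -[x y]; have := noX x.
rewrite expect_pair /=; apply: eq_expect => x; exact: (expect_cst x0).
Qed.

Lemma mix_set0 x y : mix set0 x y = x.
Proof. by apply/ffunP => j; rewrite mixE inE. Qed.

Definition depends_on e F : Prop :=
  forall x y, (forall j, j \in e -> x j = y j) -> F x = F y.

Definition cond_expect e F x : R := expect (fun y => F (mix e y x)).

Lemma depends_on_cond e F : depends_on e (cond_expect e F).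
Proof.
move=> x y xy; apply: eq_expect => z; congr F; apply/ffunP => j.
by rewrite !mixE; case: ifP => // /xy.
Qed.

Lemma expect_cond e u F : depends_on e u ->
  expect (fun x => u x * cond_expect e F x) = expect (fun x => u x * F x).
Proof.
move=> eu; rewrite -(expect_mix e (fun x => u x * F x)) exchange_expect.
apply: eq_expect => x; rewrite -expectZ; apply: eq_expect => y.
by congr (_ * _); apply: eu => j je; rewrite mixE je.
Qed.

(** Each conditional expectation brings its own copy of the coordinates outside
    [e]; the copy belonging to [F] is merged into [x]. *)
Lemma expect_cond2 e u F G : depends_on e u ->
  expect (fun x => u x * (cond_expect e F x * cond_expect e G x)) =
  expect (fun x => expect (fun y => u x * (F x * G (mix e y x)))).
Proof.
move=> eu.
have euG : depends_on e (fun x => u x * cond_expect e G x).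
  by move=> x y xy; rewrite (eu x y xy) (depends_on_cond G xy).
transitivity (expect (fun x => (u x * cond_expect e G x) * F x)).
  rewrite -(expect_cond _ euG); apply: eq_expect => x; ring.
apply: eq_expect => x; rewrite mulrAC -expectZ; apply: eq_expect => y; ring.
Qed.

Lemma ler_cond_expect e F G x :
  (forall y, F y <= G y) -> cond_expect e F x <= cond_expect e G x.
Proof. by move=> FG; apply: ler_expect => y. Qed.

Lemma cond_expect_ge0 e F x : (forall y, 0 <= F y) -> 0 <= cond_expect e F x.
Proof. by move=> F0; apply: expect_ge0 => y. Qed.

End Mix.

(** * Discrepancy *)

Section Discrepancy.
Variables (R : realType) (J : finType) (V : J -> finType).
Notation X := (VJ V).
Implicit Types (x y z : X) (e f : {set J}) (F G Phi : X -> R).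

(** This is the form in which discrepancy is used: as each test function misses
    some coordinate in [e], freezing the coordinates outside [e] turns their
    product into a product of functions on the facets of [e]. *)
Definition low_discrepancy (eps : R) e Phi : Prop :=
  forall (E : {set {set J}}) (h : {set J} -> X -> R),
    (forall e', e' \in E -> ~~ (e \subset e')) ->
    (forall e', e' \in E -> depends_on e' (h e')) ->
    (forall e', e' \in E -> forall x, 0 <= h e' x <= 1) ->
  `|expect (fun x => Phi x * \prod_(e' in E) h e' x)| <= eps.

(** A linear functional on the cube of [0,1]-valued functions of [x_e] has its
    extreme values at indicator functions: take the sets where the conditional
    expectation of [Phi] is positive, or negative. *)
Lemma indicator_extremal e Phi h :
  depends_on e h -> (forall x, 0 <= h x <= 1) ->
  exists2 b : pred X, depends_on e (fun x => (b x)%:R : R) &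
    `|expect (fun x => Phi x * h x)| <= `|expect (fun x => Phi x * (b x)%:R)|.
Proof.
move=> eh h01; pose c := cond_expect e Phi.
have ce : depends_on e c by apply: depends_on_cond.
have toc u : depends_on e u ->
    expect (fun x => Phi x * u x) = expect (fun x => u x * c x).
  by move=> eu; rewrite expect_cond//; apply: eq_expect => x; rewrite mulrC.
have bd (b : pred X) : (forall x y, c x = c y -> b x = b y) ->
    depends_on e (fun x => (b x)%:R : R).
  by move=> cb x y xy; rewrite (cb _ _ (ce _ _ xy)).
have p_dep : depends_on e (fun x => (0 < c x)%R%:R : R) by apply: bd => x y ->.
have n_dep : depends_on e (fun x => (c x < 0)%R%:R : R) by apply: bd => x y ->.
have ub : expect (fun x => Phi x * h x) <= expect (fun x => Phi x * (0 < c x)%R%:R).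
  rewrite !toc//; apply: ler_expect => x; have /andP[h0 h1] := h01 x.
  by case: ltrP => cx; rewrite ?mul1r ?mul0r; nra.
have lb : expect (fun x => Phi x * (c x < 0)%R%:R) <= expect (fun x => Phi x * h x).
  rewrite !toc//; apply: ler_expect => x; have /andP[h0 h1] := h01 x.
  by case: ltrP => cx; rewrite ?mul1r ?mul0r; nra.
have [Eh0|Eh0] := lerP 0 (expect (fun x => Phi x * h x)).
  exists (fun x => 0 < c x) => //.
  by rewrite ger0_norm// (le_trans ub)// ler_norm.
exists (fun x => c x < 0) => //.
by rewrite ltr0_norm// -normrN (le_trans _ (ler_norm _))// lerN2.
Qed.

Lemma low_discrepancy_indicator eps e Phi :
  (forall (E : {set {set J}}) (h : {set J} -> pred X),
    (forall e', e' \in E -> ~~ (e \subset e')) ->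
    (forall e', e' \in E -> depends_on e' (fun x => (h e' x)%:R : R)) ->
    `|expect (fun x => Phi x * \prod_(e' in E) (h e' x)%:R)| <= eps) ->
  low_discrepancy eps e Phi.
Proof.
move=> ind E h EeN.
(* The functions outside [T] are already indicators. *)
suff: forall n (T : {set {set J}}) (h : {set J} -> X -> R), #|T| = n ->
    (forall e', e' \in E -> depends_on e' (h e')) ->
    (forall e', e' \in E -> forall x, 0 <= h e' x <= 1) ->
    (forall e', e' \notin T -> exists b : pred X, h e' =1 fun x => (b x)%:R) ->
    `|expect (fun x => Phi x * \prod_(e' in E) h e' x)| <= eps.
  move=> main hdep h01; apply: (main _ [set: {set J}] h) => // e'.
  by rewrite inE.
elim=> [|n IHn] T {}h cT hdep h01 hb.
  have T0 : T = set0 by apply/cards0_eq.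
  pose b e' x := h e' x == 1.
  have hbE e' : h e' =1 fun x => (b e' x)%:R.
    have [|c cE] := hb e'; first by rewrite T0 inE.
    by move=> x; rewrite /b cE; case: (c x); rewrite ?eqxx// eq_sym oner_eq0.
  have := ind E b EeN; under eq_expect do under eq_bigr do rewrite -hbE.
  by apply=> e' e'E x y xy; rewrite -!hbE; apply: hdep.
have /card_gt0P [e' e'T] : (0 < #|T|)%N by rewrite cT.
have cT' : #|T :\ e'| = n by move: cT; rewrite (cardsD1 e') e'T => -[].
have [e'E|e'E] := boolP (e' \in E); last first.
  pose h' f := if f == e' then (fun=> 1) else h f.
  have := IHn (T :\ e') h' cT'.
  have -> : expect (fun x => Phi x * \prod_(f in E) h' f x) =
            expect (fun x => Phi x * \prod_(f in E) h f x).
    apply: eq_expect => x; congr (_ * _); apply: eq_bigr => f fE.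
    by rewrite /h'; case: eqP => // fe'; rewrite fe' (negbTE e'E) in fE.
  apply.
  - by move=> f fE; rewrite /h'; case: eqP => // _; apply: hdep.
  - by move=> f fE x; rewrite /h'; case: eqP => [|_]; [rewrite ler01 lexx|apply: h01].
  - move=> f; rewrite !inE negb_and negbK /h'; case: eqP => /= [_ _|_]; last exact: hb.
    by exists predT.
pose Psi x := Phi x * \prod_(f in E | f != e') h f x.
have PsiE u : expect (fun x => Psi x * u x) =
    expect (fun x => Phi x * \prod_(f in E) (if f == e' then u else h f) x).
  apply: eq_expect => x; rewrite (bigD1 e')//= eqxx -mulrA [_ * u x]mulrC.
  by congr (_ * (_ * _)); apply: eq_bigr => f /andP[_ /negbTE ->].
have [b bdep] := indicator_extremal Psi (hdep _ e'E) (h01 _ e'E).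
rewrite !PsiE => /[dup] le1 _; rewrite (le_trans _ (le_trans le1 _))//.
  rewrite le_eqVlt; apply/orP; left; apply/eqP; congr (`|_|); apply: eq_expect => x.
  by congr (_ * _); apply: eq_bigr => f _; case: eqP => // ->.
apply: (IHn (T :\ e')) => //.
- by move=> f fE; case: eqP => [->//|_]; apply: hdep.
- move=> f fE x; case: eqP => _; last exact: h01.
  by rewrite ler0n lern1; case: (b x).
- move=> f; rewrite !inE negb_and negbK; case: eqP => /= [_ _|_]; last exact: hb.
  by exists b.
Qed.

(** All fibres of the restriction to [e] have the same size, being translated
    into each other by [mix]. *)
Lemma expect_restrJ (x0 : X) e (F : Vset V e -> R) :
  expect (fun x : X => F (restrJ e x)) = expect F.
Proof.
pose ext (v : Vset V e) : X :=
  [ffun j => match boolP (j \in e) with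
             | AltTrue je => v (exist _ j je) | AltFalse _ => x0 j end].
have extK v : restrJ e (ext v) = v.
  apply/ffunP => -[j je]; rewrite !ffunE /=.
  case: {-}_ / boolP => [je'|]; last by rewrite je.
  by rewrite (bool_irrelevance je' je).
pose fib v := [set x : X | restrJ e x == v].
have fibP v x : x \in fib v -> forall j (je : j \in e), x j = v (exist _ j je).
  by rewrite inE => /eqP <- j je; rewrite ffunE.
have le_fib v w : (#|fib v| <= #|fib w|)%N.
  rewrite -(card_in_imset (f := fun x => mix e x (ext w))); last first.
    move=> x y xv yv /ffunP xy; apply/ffunP => j; have := xy j; rewrite !mixE.
    have [je _|//] := boolP (j \in e).
    by rewrite (fibP _ _ xv j je) (fibP _ _ yv j je).
  apply/subset_leq_card/subsetP => _ /imsetP[x _ ->]; rewrite inE.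
  rewrite -[X in _ == X]extK; move: (ext w) => z; apply/eqP/ffunP => j.
  by rewrite !ffunE (valP j).
pose v0 := restrJ e x0.
have fib_card v : #|fib v| = #|fib v0| by apply/eqP; rewrite eqn_leq !le_fib.
have fib0 : #|fib v0|%:R != 0 :> R.
  by rewrite pnatr_eq0 -lt0n; apply/card_gt0P; exists x0; rewrite inE.
have sumE (G : Vset V e -> R) : \sum_(x : X) G (restrJ e x) = #|fib v0|%:R * \sum_v G v.
  rewrite (partition_big (restrJ e) predT)//= mulr_sumr; apply: eq_bigr => v _.
  rewrite (eq_bigr (fun=> G v)) => [|x /eqP ->//].
  rewrite sumr_const -(fib_card v) mulr_natl; congr (_ *+ _).
  by apply: eq_card => x; rewrite inE.
have cardE : #|X|%:R = #|fib v0|%:R * #|Vset V e|%:R :> R.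
  by have := sumE (fun=> 1); rewrite !sumr_const.
by rewrite /expect sumE cardE -mulf_div divff ?mul1r.
Qed.

Lemma depends_on_restrJ e (F : Vset V e -> R) :
  depends_on e (fun x : X => F (restrJ e x)).
Proof. by move=> x y xy; congr F; apply/ffunP => j; rewrite !ffunE xy ?(valP j). Qed.

(** With the coordinates outside [e] frozen, a set on the coordinates [e'] not
    containing [e] becomes a set on the facet [e :\ j], where [j] is in [e] but
    not in [e'].  The sets landing on the same facet are intersected. *)
Lemma discrepancy_pair_low (x0 : X) (H : {set {set J}}) eps (g g' : weights R V) e :
  discrepancy_pair H eps g g' -> e \in H ->
  low_discrepancy eps e (fun x => g e (restrJ e x) - g' e (restrJ e x)).
Proof.
move=> dp eH; pose Phi (x : X) := g e (restrJ e x) - g' e (restrJ e x).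
apply: (@low_discrepancy_indicator eps e Phi) => E h EeN hdep.
have Phi_dep : depends_on e Phi.
  exact: (depends_on_restrJ (fun v => g e v - g' e v)).
have -> : expect (fun x => Phi x * \prod_(e' in E) (h e' x)%:R) =
  expect (fun y => expect (fun x => Phi x * \prod_(e' in E) (h e' (mix e y x))%:R)).
  rewrite -(expect_mix e (fun x => Phi x * _)); apply: eq_expect => x.
  by apply: eq_expect => y; congr (_ * _); apply: Phi_dep => j je; rewrite mixE je.
apply: le_expect_cst => // y.
pose facet e' := if [pick j in e :\: e'] is Some j then e :\ j else e.
have facetP e' : e' \in E -> (facet e' \in bdry e) && (e :&: e' \subset facet e').
  move=> /EeN /subsetPn[k ke ke']; rewrite /facet.
  case: pickP => [j|/(_ k)]; rewrite inE ?ke' ?ke// => /andP[je' je].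
  rewrite inE properD1//= (cardsD1 j e) je eqxx/=; apply/subsetP => i.
  rewrite !inE => /andP[-> ie']; rewrite andbT.
  by apply: contraNneq je' => <-.
pose S f := [set x : X | [forall e' in E, (facet e' == f) ==> h e' (mix e y x)]].
pose B f : {set Vset V f} := [set restrJ f x | x in S f].
have BE f x : (restrJ f x \in B f) = (x \in S f).
  apply/imsetP/idP => [[z zS]|xS]; last by exists x.
  move=> /ffunP xz; have {}xz j : j \in f -> x j = z j.
    by move=> jf; have := xz (exist _ j jf); rewrite !ffunE.
  move: zS; rewrite !inE => /forall_inP zS; apply/forall_inP => e' e'E.
  apply/implyP => /eqP fE; have := zS _ e'E; rewrite fE eqxx /=.
  have -> // : h e' (mix e y x) = h e' (mix e y z).
  have /(_ _ _) := hdep _ e'E; move/(_ (mix e y x) (mix e y z)).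
  have mixxz j : j \in e' -> mix e y x j = mix e y z j.
    move=> je'; rewrite !mixE; case: ifP => // je; apply: xz.
    have /andP[_ /subsetP sub] := facetP _ e'E; rewrite -fE; apply: sub.
    by rewrite inE je.
  move=> /(_ mixxz) /eqP; rewrite eqr_nat.
  by case: (h e' _); case: (h e' _).
have := dp e eH B; rewrite -(expect_restrJ x0).
congr (`|_| <= _); apply: eq_expect => x; congr (_ * _).
have sub (f : {f : {set J} | f \in bdry e}) :
    restr (bdry_subset f) (restrJ e x) = restrJ (val f) x.
  by apply/ffunP => j; rewrite !ffunE.
rewrite (eq_bigr (fun f : {f | f \in bdry e} => (x \in S (val f))%:R));
    last first => [f _|].
  by rewrite -BE -sub.
have prod_nat (I : finType) (P : pred I) (b : I -> bool) :
    \prod_(i | P i) (b i)%:R = [forall (i | P i), b i]%:R :> R.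
  have [/forall_inP bP|/forall_inPn[i Pi /negbTE biF]] := boolP [forall (i | P i), b i].
    by rewrite big1// => i /bP ->.
  by rewrite (bigD1 i)//= biF mul0r.
rewrite !prod_nat; congr (_ %:R); congr nat_of_bool.
apply/forall_inP/forall_inP => [all e' e'E|all [f fe] _].
  have /andP[fb _] := facetP _ e'E.
  have := all (exist (fun f => f \in bdry e) _ fb) isT.
  rewrite inE => /forall_inP/(_ _ e'E).
  by rewrite eqxx.
by rewrite inE; apply/forall_inP => e' /all he'; apply/implyP.
Qed.

End Discrepancy.

(** * Linear forms *)

Section LinearForms.
Variables (R : realType) (J : finType) (V : J -> finType).
Notation X := (VJ V).
Implicit Types (x y z t : X) (D e w : {set J}) (K : {set {set J} * {set J}}).

(** The pair [(e, w)] stands for the factor [nu_e] evaluated at the point whose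
    coordinates in [w] are taken from the second copy. *)
Definition linear_form_on (nu : {set J} -> X -> R) K : R :=
  expect (fun x => expect (fun y => \prod_(p in K) nu p.1 (mix p.2 x y))).

Definition linear_forms_within (delta : R) (H : {set {set J}})
    (nu : {set J} -> X -> R) : Prop :=
  forall K, (forall p, p \in K -> (p.1 \in H) && (p.2 \subset p.1)) ->
    `|linear_form_on nu K - 1| <= delta.

Lemma linear_form_onE (H : {set {set J}}) (nu : weights R V) K :
  (forall p, p \in K -> (p.1 \in H) && (p.2 \subset p.1)) ->
  linear_form H nu (fun e omega => (e, [set val j | j : elt e & omega j]) \in K) =
  linear_form_on (fun e x => nu e (restrJ e x)) K.
Proof.
move=> KP; rewrite /linear_form expect_pair; apply: eq_expect => x.
apply: eq_expect => y /=.
transitivity (\prod_(e in H) \prod_(w | (e, w) \in K) nu e (restrJ e (mix w x y)));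
    last first.
  rewrite pair_big_dep; apply: eq_bigl => -[e w] /=.
  by case eK: (_ \in K); rewrite ?andbF// andbT; have /andP[] := KP _ eK.
apply: eq_bigr => e eH.
rewrite (reindex_onto
  (fun omega : {ffun elt e -> bool} => [set val j | j : elt e & omega j])
  (fun w => [ffun j : elt e => val j \in w])); last first.
  move=> w /KP /andP[_ /= /subsetP we]; apply/setP => j; apply/imsetP/idP.
    by move=> [i + ->]; rewrite inE ffunE.
  by move=> jw; exists (exist _ j (we _ jw)); rewrite // inE ffunE.
rewrite [RHS](eq_bigl (fun omega : {ffun elt e -> bool} =>
  (e, [set val j | j : elt e & omega j]) \in K)); last first.
  move=> omega; case: (_ \in K) => //=; apply/eqP/ffunP => j; rewrite ffunE.
  by rewrite (mem_imset _ _ val_inj) inE.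
rewrite [RHS]big_mkcond; apply: eq_bigr => omega _.
case: ifP => _; rewrite ?expr0// expr1; congr (nu e _); apply/ffunP => j.
by rewrite !ffunE (mem_imset _ _ val_inj) inE.
Qed.

End LinearForms.

(** * Removing the weights by repeated Cauchy-Schwarz *)

Section CauchySchwarz.
Variables (R : realType) (J : finType) (V : J -> finType).
Notation X := (VJ V).
Implicit Types (x y z t : X) (D e w : {set J}).

Lemma prod_powersetU1 (j : J) D (F : {set J} -> R) : j \notin D ->
  \prod_(w : {set J} | w \subset j |: D) F w =
  \prod_(w : {set J} | w \subset D) F w *
  \prod_(w : {set J} | w \subset D) F (j |: w).
Proof.
move=> jD; rewrite (bigID (fun w => j \notin w)) /=; congr (_ * _).
  by apply: eq_bigl => w; rewrite -subsetD1 setU1K.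
rewrite (reindex_onto (fun w => j |: w) (fun w => w :\ j)) /=; last first.
  by move=> w /andP[_]; rewrite negbK => /setD1K.
apply: eq_bigl => w; rewrite setU11 andbT.
have [jw|jw] := boolP (j \in w).
  have -> : (w \subset D) = false.
    by apply/negP => /subsetP/(_ _ jw); rewrite (negbTE jD).
  apply/negbTE; rewrite negb_and orbC; apply/orP; left.
  by apply: contraTneq jw => <-; rewrite !inE eqxx.
rewrite setU1K// eqxx andbT subUset sub1set setU11 /=.
by rewrite -[in RHS](setU1K jD) subsetD1 jw andbT.
Qed.

(** The Cauchy-Schwarz inequality in the coordinate [j], which doubles [x_j]:
    as [B] and [W] do not depend on the coordinate [j] of [y], it can serve as
    the second copy. *)
Lemma cauchy_schwarz_coord (j : J) (A B W : X -> X -> R) :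
  (forall x y, 0 <= A x y <= W x y) ->
  (forall x y t, A (mix [set j] x t) y = A x y) ->
  (forall x y t, W (mix [set j] x t) y = W x y) ->
  (forall x y t, W x (mix [set j] y t) = W x y) ->
  (forall x y t, B x (mix [set j] y t) = B x y) ->
  expect (fun x => expect (fun y => A x y * B x y)) ^+ 2 <=
  expect (fun x => expect (fun y => W x y)) *
  expect (fun x => expect (fun y => W x y * (B x y * B (mix [set j] x y) y))).
Proof.
move=> AW Ax Wx Wy By.
pose C x y := expect (fun t => B (mix [set j] x t) y).
have CE (U : X -> X -> R) : (forall x y t, U (mix [set j] x t) y = U x y) ->
    expect (fun x => expect (fun y => U x y * C x y)) =
    expect (fun x => expect (fun y => U x y * B x y)).
  move=> Ux; rewrite exchange_expect [RHS]exchange_expect; apply: eq_expect => y.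
  rewrite -(expect_mix [set j] (fun x => U x y * B x y)); apply: eq_expect => x.
  by rewrite -expectZ; apply: eq_expect => t; rewrite Ux.
have Cx x y t : C (mix [set j] x t) y = C x y.
  apply: eq_expect => s; congr B; apply/ffunP => i; rewrite !mixE.
  by case: (i \in _).
rewrite -CE//.
have -> : expect (fun x => expect (fun y => W x y * (B x y * B (mix [set j] x y) y))) =
    expect (fun x => expect (fun y => W x y * C x y ^+ 2)).
  transitivity (expect (fun x => expect (fun y => (W x y * C x y) * B x y))).
    apply: eq_expect => x.
    pose F z := W x z * (B x z * B (mix [set j] x z) z).
    rewrite -[LHS](expect_mix [set j] F); apply: eq_expect => y.
    rewrite mulrAC -expectZ; apply: eq_expect => t; rewrite /F Wy By By mulrA.
    congr (_ * _ * B _ _); apply/ffunP => i; rewrite !mixE.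
    by case: (i \in _).
  rewrite -CE => [|x y t]; last by rewrite Wx Cx.
  by apply: eq_expect => x; apply: eq_expect => y; rewrite -mulrA expr2.
have le_abs : expect (fun x => expect (fun y => A x y * C x y)) ^+ 2 <=
    expect (fun x => expect (fun y => W x y * `|C x y|)) ^+ 2.
  rewrite -real_normK ?num_real// lerXn2r ?nnegrE//.
    apply: expect_ge0 => x; apply: expect_ge0 => y; have /andP[A0 AW'] := AW x y.
    by rewrite mulr_ge0// (le_trans A0).
  rewrite (le_trans (ler_norm_expect _))//; apply: ler_expect => x.
  rewrite (le_trans (ler_norm_expect _))//; apply: ler_expect => y.
  have /andP[A0 AW'] := AW x y.
  by rewrite normrM ger0_norm// ler_wpM2r.
rewrite (le_trans le_abs)//.
have W0 (p : X * X) : 0 <= W p.1 p.2.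
  by have /andP[A0] := AW p.1 p.2; apply: le_trans.
have := cauchy_schwarz_expect (fun p : X * X => `|C p.1 p.2|) W0.
rewrite !expect_pair /=.
by under [X in _ <= _ * X -> _]eq_expect do
  under eq_expect do rewrite real_normK ?num_real//.
Qed.

End CauchySchwarz.

Section BoxNorm.
Variables (R : realType) (J : finType) (V : J -> finType).
Notation X := (VJ V).
Implicit Types (x y z t : X) (D e w : {set J}).
Variables (e1 : {set J}) (f : X -> R) (E : {set {set J}}).
Variables (P N : {set J} -> X -> X -> R).

(** The factors see the coordinates in [e] of the first copy; of the second copy
    they see only coordinates outside [e1], so that those in [e1] are free to
    hold the coordinates produced by the doublings. *)
Definition adapted e (U : X -> X -> R) : Prop :=
  (forall y, depends_on e (U^~ y)) /\ (forall x, depends_on (~: e1) (U x)).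

Hypothesis P_bound : forall e, e \in E -> forall x y, 0 <= P e x y <= N e x y.
Hypothesis P_adapted : forall e, e \in E -> adapted e (P e).
Hypothesis N_adapted : forall e, e \in E -> adapted e (N e).

(** Once some coordinate outside [e] has been doubled, the factor at [e] has been
    replaced by its majorant. *)
Definition box_factor D e := if D \subset e then P e else N e.

Definition doubled D (U : {set J} -> X -> X -> R) (F : {set {set J}}) x y : R :=
  \prod_(e in F) \prod_(w : {set J} | w \subset D :&: e) U e (mix w x y) y.

(** The average obtained from [f] and the factors [P] after doubling the
    coordinates in [D]. *)
Definition box_average D : R :=
  expect (fun x => expect (fun y =>
    \prod_(w : {set J} | w \subset D) f (mix w x y) * doubled D (box_factor D) E x y)).

Definition majorant_average D (F : {set {set J}}) : R :=
  expect (fun x => expect (fun y => doubled D N F x y)).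

Lemma box_factor_adapted D e : e \in E -> adapted e (box_factor D e).
Proof. by rewrite /box_factor; case: ifP => _; [apply: P_adapted|apply: N_adapted]. Qed.

Lemma doubled_mixl D U (F : {set {set J}}) j x y t :
  (forall e, e \in F -> adapted e (U e)) -> (forall e, e \in F -> j \notin e) ->
  doubled D U F (mix [set j] x t) y = doubled D U F x y.
Proof.
move=> Uad jF; apply: eq_bigr => e eF; apply: eq_bigr => w _.
apply: (Uad e eF).1 => i ie; rewrite !mixE inE; case: (i \in w) => //.
by case: eqP => // ij; move: (jF e eF); rewrite -ij ie.
Qed.

Lemma doubled_mixr D U (F : {set {set J}}) j x y t :
  (forall e, e \in F -> adapted e (U e)) -> j \in e1 -> j \notin D ->
  doubled D U F x (mix [set j] y t) = doubled D U F x y.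
Proof.
move=> Uad je1 jD; apply: eq_bigr => e eF; apply: eq_bigr => w wD.
have -> : mix w x (mix [set j] y t) = mix w x y.
  apply/ffunP => i; rewrite !mixE inE; case: ifP => // iw; case: eqP => // ij.
  by move: wD; rewrite subsetI => /andP[/subsetP/(_ i iw)]; rewrite ij (negbTE jD).
apply: (Uad e eF).2 => i; rewrite mixE !inE; case: eqP => // ->.
by rewrite je1.
Qed.

Lemma mix_setU1 j w x y : mix w (mix [set j] x y) y = mix (j |: w) x y.
Proof. by apply/ffunP => i; rewrite !mixE !inE; case: (i \in w); rewrite ?orbT ?orbF. Qed.

(** Factors at the edges avoiding [j] are pulled out of the average over [x_j]
    and replaced by majorants; the other factors, and [f], are doubled. *)
Lemma box_average_step D j : j \in e1 -> j \notin D ->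
  box_average D ^+ 2 <=
  majorant_average D [set e in E | j \notin e] * box_average (j |: D).
Proof.
move=> je1 jD; set E0 := [set e in E | j \notin e].
pose E1 := [set e in E | j \in e].
have E0P e : e \in E0 -> e \in E by rewrite inE => /andP[].
have E1P e : e \in E1 -> e \in E by rewrite inE => /andP[].
have E0j e : e \in E0 -> j \notin e by rewrite inE => /andP[].
have E1j e : e \in E1 -> j \in e by rewrite inE => /andP[].
have split D' U x y : doubled D' U E x y = doubled D' U E0 x y * doubled D' U E1 x y.
  rewrite /doubled (bigID (fun e => j \notin e)) /=; congr (_ * _).
    by apply: eq_bigl => e; rewrite inE.
  by apply: eq_bigl => e; rewrite inE negbK.
pose A x y := doubled D (box_factor D) E0 x y.
pose B x y := \prod_(w : {set J} | w \subset D) f (mix w x y) *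
              doubled D (box_factor D) E1 x y.
pose W x y := doubled D N E0 x y.
have N0 e x y : e \in E -> 0 <= N e x y.
  by move=> /P_bound/(_ x y)/andP[]; apply: le_trans.
have -> : box_average D = expect (fun x => expect (fun y => A x y * B x y)).
  by apply: eq_expect => x; apply: eq_expect => y; rewrite split /A /B mulrCA.
have -> : box_average (j |: D) =
    expect (fun x => expect (fun y => W x y * (B x y * B (mix [set j] x y) y))).
  apply: eq_expect => x; apply: eq_expect => y.
  have -> : doubled (j |: D) (box_factor (j |: D)) E x y =
      W x y * (doubled D (box_factor D) E1 x y *
               doubled D (box_factor D) E1 (mix [set j] x y) y).
    rewrite split; congr (_ * _).
      apply: eq_bigr => e /E0j jNe; rewrite /box_factor subUset sub1set (negbTE jNe) /=.
      apply: eq_bigl => w; rewrite setIUl.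
      suff -> : [set j] :&: e = set0 by rewrite set0U.
      by apply/setP => i; rewrite !inE; case: eqP => // ->; rewrite (negbTE jNe).
    rewrite -big_split; apply: eq_bigr => e /E1j je /=.
    have -> : (j |: D) :&: e = j |: (D :&: e).
      by rewrite setIUl (setIidPl _)// sub1set.
    rewrite prod_powersetU1 ?inE ?(negbTE jD)// /box_factor subUset sub1set je /=.
    by congr (_ * _); apply: eq_bigr => w _; rewrite mix_setU1.
  rewrite prod_powersetU1// mulrCA; congr (_ * _); rewrite mulrACA /B.
  by congr (_ * (_ * _)); apply: eq_bigr => w _; rewrite mix_setU1.
apply: cauchy_schwarz_coord.
- move=> x y; rewrite /A /W.
  have Fb e x' y' : e \in E0 -> 0 <= box_factor D e x' y' <= N e x' y'.
    move=> /E0P eE; rewrite /box_factor; case: ifP => _; first exact: P_bound.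
    by rewrite N0// lexx.
  rewrite prodr_ge0 => [|e eE]; last first.
    by apply: prodr_ge0 => w _; have /andP[] := Fb e (mix w x y) y eE.
  apply: ler_prod => e eE; rewrite prodr_ge0 => [|w _]; last first.
    by have /andP[] := Fb e (mix w x y) y eE.
  by apply: ler_prod => w _; apply: Fb.
- by move=> x y t; apply: doubled_mixl => // e /E0P; apply: box_factor_adapted.
- by move=> x y t; apply: doubled_mixl => // e /E0P; apply: N_adapted.
- by move=> x y t; apply: doubled_mixr => // e /E0P; apply: N_adapted.
- move=> x y t; rewrite /B doubled_mixr// => [|e /E1P]; last exact: box_factor_adapted.
  congr (_ * _); apply: eq_bigr => w wD; congr f; apply/ffunP => i; rewrite !mixE inE.
  case: ifP => // iw; case: eqP => // ij.
  by move: (subsetP wD i iw); rewrite ij (negbTE jD).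
Qed.

(** Each doubling squares the average at the cost of a factor [2]; halving the
    averages makes the recursion an exact squaring. *)
Lemma box_average_le D :
  (forall D j, D \subset e1 -> `|majorant_average D [set e in E | j \notin e]| <= 2) ->
  D \subset e1 ->
  (`|box_average set0| / 2) ^+ (2 ^ #|D|) <= `|box_average D| / 2.
Proof.
move=> maj2; have [n cD] := ubnP #|D|; elim: n => // n IHn in D cD *.
have [->|/set0Pn[j jD]] := eqVneq D set0; first by rewrite cards0 expr1.
move=> De1; have {}cD : (#|D :\ j| < n)%N by move: cD; rewrite (cardsD1 j D) jD.
have De1' : D :\ j \subset e1 by apply: subset_trans De1; apply: subD1set.
have IH := IHn _ cD De1'.
have step := @box_average_step (D :\ j) j (subsetP De1 j jD) (negbT (setD11 _ _)).
rewrite setD1K// in step.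
rewrite (cardsD1 j D) jD expnS mulnC exprM.
have q0 : 0 <= `|box_average (D :\ j)| / 2 by rewrite divr_ge0.
rewrite (le_trans (_ : _ <= (`|box_average (D :\ j)| / 2) ^+ 2))//.
  by rewrite lerXn2r ?nnegrE// exprn_ge0// divr_ge0.
have : `|box_average (D :\ j)| ^+ 2 <= 2 * `|box_average D|.
  rewrite real_normK ?num_real// (le_trans step)// (le_trans (ler_norm _))// normrM.
  by rewrite ler_wpM2r// maj2.
by nra.
Qed.

End BoxNorm.

(** * The strong linear forms property *)

Section StrongLinearForms.
Variables (R : realType) (J : finType) (V : J -> finType).
Notation X := (VJ V).
Implicit Types (x y z t : X) (D e w : {set J}) (K : {set {set J} * {set J}}).
Variables (delta : R) (H : {set {set J}}) (nu : {set J} -> X -> R).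
Hypothesis nu_forms : linear_forms_within delta H nu.
Hypothesis nu_dep : forall e, e \in H -> depends_on e (nu e).

(** Expanding one factor [nu - 1] at a time leaves differences of linear forms,
    each of which is close to [1]. *)
Lemma balanced_linear_form e1 (T : {set {set J}}) K :
  e1 \in H -> (forall w, w \in T -> (w \subset e1) && ((e1, w) \notin K)) ->
  (forall p, p \in K -> (p.1 \in H) && (p.2 \subset p.1)) ->
  `|expect (fun x => expect (fun y =>
      \prod_(w in T) (nu e1 (mix w x y) - 1) *
      \prod_(p in K) nu p.1 (mix p.2 x y))) - (T == set0)%:R|
  <= 2 ^+ #|T| * delta.
Proof.
move=> e1H; have [n cT] := ubnP #|T|; elim: n => // n IHn in T K cT * => TP KP.
have [T0|/set0Pn[w wT]] := eqVneq T set0.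
  rewrite T0 cards0 expr0 mul1r.
  under eq_expect do under eq_expect do rewrite big_set0 mul1r.
  exact: nu_forms.
rewrite subr0; have /andP[we1 wK] := TP w wT.
pose T' := T :\ w; pose K' := (e1, w) |: K.
have cT' : (#|T'| < n)%N by move: cT; rewrite (cardsD1 w T) wT.
have T'P v : v \in T' -> (v \subset e1) && ((e1, v) \notin K').
  rewrite !inE => /andP[vw /TP /andP[-> /negbTE ->]].
  by rewrite orbF xpair_eqE eqxx.
have K'P p : p \in K' -> (p.1 \in H) && (p.2 \subset p.1).
  by rewrite !inE => /predU1P[->|/KP//]; rewrite e1H.
have T'PK v : v \in T' -> (v \subset e1) && ((e1, v) \notin K).
  by rewrite !inE => /andP[_ /TP].
have b1 := IHn T' K' cT' T'P K'P; have b2 := IHn T' K cT' T'PK KP.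
set q1 := expect _ in b1; set q2 := expect _ in b2.
have -> : expect (fun x => expect (fun y =>
      \prod_(v in T) (nu e1 (mix v x y) - 1) *
      \prod_(p in K) nu p.1 (mix p.2 x y))) = q1 - q2.
  rewrite /q1 /q2 -expectB; apply: eq_expect => x; rewrite -expectB.
  apply: eq_expect => y; rewrite (big_setD1 w wT) big_setU1//=; ring.
rewrite (cardsD1 w T) wT exprS.
have -> : q1 - q2 = (q1 - (T' == set0)%:R) - (q2 - (T' == set0)%:R) by ring.
rewrite (le_trans (ler_normB _ _))// (le_trans (lerD b1 b2))//.
by rewrite -mulrA mulr_natl mulr2n.
Qed.

Section Majorant.
Variables (e1 : {set J}) (al be : bool).

(** Where the factors of a majorant average sit: the copies with the coordinates
    of [D] doubled, and the same with all coordinates outside [e1] taken from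
    the second copy. *)
Definition doubled_positions (F : {set {set J}}) D : {set {set J} * {set J}} :=
  [set p : {set J} * {set J} | [&& p.1 \in F, p.2 \subset p.1 &
    (al && (p.2 \subset D)) ||
    (be && (p.1 :\: e1 \subset p.2) && (p.2 :&: e1 \subset D))]].

(** [al] and [be] tell whether the functions evaluated at the first and at the
    second copy are bounded by [nu] or by [1]. *)
Definition majorant e x y : R := nu e x ^+ al * nu e (mix e1 y x) ^+ be.

Lemma prod_doubled_positions (F : {set {set J}}) D x y :
  D \subset e1 -> (forall e, e \in F -> (e \in H) && ~~ (e \subset e1)) ->
  doubled D majorant F x y =
  \prod_(p in doubled_positions F D) nu p.1 (mix p.2 x y).
Proof.
move=> De1 FP.
transitivity (\prod_(e in F) \prod_(w | (e, w) \in doubled_positions F D)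
    nu e (mix w x y)); last first.
  rewrite pair_big_dep; apply: eq_bigl => -[e w] /=.
  by rewrite inE /=; case: (e \in F).
apply: eq_bigr => e eF; have /andP[eH ene1] := FP e eF.
have outside w : e :\: e1 \subset w -> (w \subset e1) = false.
  move=> ew; apply: contraNF ene1 => we1; rewrite -setD_eq0.
  apply/eqP/setP => i; rewrite [RHS]inE; apply/negP => ie.
  by have := subsetP we1 i (subsetP ew i ie); move: ie; rewrite inE => /andP[/negbTE ->].
rewrite big_split [RHS](bigID (fun w => w \subset e1)) /=; congr (_ * _).
  rewrite [RHS](eq_bigl (fun w => al && (w \subset D :&: e))) => [|w]; last first.
    rewrite inE eF /= subsetI; have [we1|we1] := boolP (w \subset e1); last first.
      rewrite andbF; apply/esym/negbTE; apply: contra we1 => /and3P[_ wD _].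
      exact: subset_trans De1.
    have -> : (e :\: e1 \subset w) = false by apply: contraTF we1 => /outside ->.
    by rewrite andbF orbF andbT; case: (al); case: (w \subset D); case: (w \subset e).
  case: al => /=; first by apply: eq_bigr => w _; rewrite expr1.
  by rewrite [RHS]big_pred0// big1.
rewrite [RHS](reindex_onto (fun w => w :|: (e :\: e1)) (fun w => w :&: e1)) /=;
    last first.
  move=> w /andP[]; rewrite inE eF /= => /andP[we] /orP[/andP[_ wD]|]; first by
    rewrite (subset_trans wD De1).
  move=> /andP[/andP[_ ew] _] _; apply/setP => i; rewrite !inE.
  have := subsetP ew i; have := subsetP we i; rewrite !inE.
  case: (i \in w); case: (i \in e); case: (i \in e1) => //= a b.
    exact: a.
  by rewrite b.
rewrite [RHS](eq_bigl (fun w => be && (w \subset D :&: e))) => [|w]; last first.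
  rewrite inE eF /= outside ?subsetUr//= !andbT.
  have -> : (w :|: e :\: e1 \subset D) = false.
    apply/negP => wD; have := subset_trans wD De1.
    by rewrite outside// subsetUr.
  rewrite andbF /=; case: be; rewrite ?andbF//= subsetI.
  have wK : w \subset e1 -> (w :|: e :\: e1) :&: e1 = w.
    move=> /setIidPl we1; rewrite setIUl we1; apply/setUidPl/subsetP => i.
    by rewrite !inE => /andP[/andP[/negbTE ->]].
  have [we1|we1] := boolP (w \subset e1).
    by rewrite wK// eqxx andbT subUset subsetDl andbT andbC.
  have -> : (w \subset D) = false.
    by apply: contraNF we1 => wD; apply: subset_trans De1.
  rewrite andbC /=; apply/negbTE; rewrite negb_and; apply/orP; left.
  by apply: contraNneq we1 => <-; apply: subsetIr.
case: be => /=; last by rewrite [RHS]big_pred0// big1.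
apply: eq_bigr => w; rewrite subsetI => /andP[wD we]; rewrite expr1.
apply: (nu_dep eH) => i ie; rewrite !mixE !inE ie andbT.
by case: (i \in e1); rewrite ?orbF ?orbT.
Qed.

Lemma majorant_averageP (F : {set {set J}}) D :
  D \subset e1 -> (forall e, e \in F -> (e \in H) && ~~ (e \subset e1)) ->
  `|majorant_average majorant D F - 1| <= delta.
Proof.
move=> De1 FP; rewrite /majorant_average.
under eq_expect do under eq_expect do rewrite prod_doubled_positions//.
apply: nu_forms => p; rewrite inE => /and3P[/FP/andP[-> _] -> _].
by [].
Qed.

(** Against products of functions bounded by [nu], where the coordinates outside
    [e1] may occur in two copies, the weight [nu e1] behaves as the constant
    [1].  After doubling every coordinate in [e1] only majorants are left. *)
Lemma strong_linear_forms (a b : {set J} -> X -> R) :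
  e1 \in H -> delta <= 1 ->
  (forall e, e \in H :\ e1 -> ~~ (e \subset e1) && ~~ (e1 \subset e)) ->
  (forall e, e \in H :\ e1 -> depends_on e (a e) /\ depends_on e (b e)) ->
  (forall e, e \in H :\ e1 -> forall x, 0 <= a e x <= nu e x ^+ al) ->
  (forall e, e \in H :\ e1 -> forall x, 0 <= b e x <= nu e x ^+ be) ->
  (`|expect (fun x => expect (fun y => (nu e1 x - 1) *
      (\prod_(e in H :\ e1) a e x * \prod_(e in H :\ e1) b e (mix e1 y x))))| / 2)
    ^+ (2 ^ #|e1|) <= 2 ^+ (2 ^ #|e1|) * delta / 2.
Proof.
move=> e1H d1 anti abdep a_bd b_bd.
have inH e : e \in H :\ e1 -> e \in H by rewrite inE => /andP[].
pose P e x y := a e x * b e (mix e1 y x).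
have ad (u v : X -> R) e : depends_on e u -> depends_on e v ->
    adapted e1 e (fun x y => u x * v (mix e1 y x)).
  move=> ue ve; split=> [y x x' xx'|x y y' yy'].
    rewrite (ue _ _ xx'); congr (_ * _); apply: ve => i ie; rewrite !mixE.
    by case: ifP => // _; apply: xx'.
  congr (u x * v _); apply/ffunP => i; rewrite !mixE; case: ifP => // ie1.
  by apply: yy'; rewrite inE ie1.
have Pad e : e \in H :\ e1 -> adapted e1 e (P e).
  by move=> /abdep[ae be']; apply: ad.
have Nad e : e \in H :\ e1 -> adapted e1 e (majorant e).
  move=> /inH eH; apply: (ad (fun x => nu e x ^+ al) (fun x => nu e x ^+ be));
    by move=> x y xy; rewrite (nu_dep eH xy).
have PN e : e \in H :\ e1 -> forall x y, 0 <= P e x y <= majorant e x y.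
  move=> eE x y; have /andP[a0 aN] := a_bd e eE x.
  have /andP[b0 bN] := b_bd e eE (mix e1 y x).
  by rewrite mulr_ge0// ler_pM.
pose f x := nu e1 x - 1.
have eP e : e \in H :\ e1 -> (e \in H) && ~~ (e \subset e1).
  by move=> eE; rewrite inH//; have /andP[->] := anti e eE.
have maj2 D j : D \subset e1 ->
    `|majorant_average majorant D [set e in H :\ e1 | j \notin e]| <= 2.
  move=> De1; set m := majorant_average _ _ _.
  have : `|m - 1| <= delta.
    by apply: majorant_averageP => // e; rewrite inE => /andP[/eP].
  by rewrite !ler_norml => /andP[lo hi]; apply/andP; split; lra.
have := box_average_le f PN Pad Nad maj2 (subxx e1).
have -> : box_average f (H :\ e1) P majorant set0 =
    expect (fun x => expect (fun y => (nu e1 x - 1) *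
      (\prod_(e in H :\ e1) a e x * \prod_(e in H :\ e1) b e (mix e1 y x)))).
  apply: eq_expect => x; apply: eq_expect => y.
  rewrite (big_pred1 set0) => [|w]; last by rewrite subset0.
  rewrite mix_set0; congr (_ * _); rewrite -big_split; apply: eq_bigr => e eE.
  rewrite (big_pred1 set0) => [|w]; last by rewrite set0I subset0.
  by rewrite mix_set0 /box_factor sub0set.
move=> le_box; rewrite (le_trans le_box)// ler_wpM2r ?invr_ge0 ?ler0n//.
have -> : box_average f (H :\ e1) P majorant e1 =
  expect (fun x => expect (fun y => \prod_(w in powerset e1) (nu e1 (mix w x y) - 1) *
    \prod_(p in doubled_positions (H :\ e1) e1) nu p.1 (mix p.2 x y))).
  apply: eq_expect => x; apply: eq_expect => y; congr (_ * _).
    by apply: eq_bigl => w; rewrite inE.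
  rewrite -prod_doubled_positions//; apply: eq_bigr => e eE; apply: eq_bigr => w _.
  by rewrite /box_factor; have /andP[_ /negbTE ->] := anti e eE.
have := @balanced_linear_form e1 (powerset e1) (doubled_positions (H :\ e1) e1) e1H.
have -> : (powerset e1 == set0) = false.
  by apply/negbTE/set0Pn; exists set0; rewrite powersetE sub0set.
rewrite subr0 card_powerset; apply.
  by move=> w; rewrite powersetE => ->; rewrite !inE eqxx.
by move=> p; rewrite inE => /and3P[/inH -> ->].
Qed.

End Majorant.
End StrongLinearForms.

(** * The counting lemma *)

Section Counting.
Variables (R : realType) (J : finType).
Implicit Types (e w : {set J}) (H : {set {set J}}).

Definition antichain H : Prop :=
  forall e e', e \in H -> e' \in H -> e != e' -> ~~ (e \subset e').

Lemma low_discrepancyW (V : J -> finType) (eps eps' : R) e (Phi : VJ V -> R) :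
  eps <= eps' -> low_discrepancy eps e Phi -> low_discrepancy eps' e Phi.
Proof. by move=> le low F h *; rewrite (le_trans (low F h _ _ _)). Qed.

Lemma linear_forms_withinW (V : J -> finType) (d d' : R) H (nu : {set J} -> VJ V -> R) :
  d <= d' -> linear_forms_within d H nu -> linear_forms_within d' H nu.
Proof. by move=> le lf K KP; rewrite (le_trans (lf K KP)). Qed.

(** When all functions are bounded by [1] they can be exchanged one at a time,
    each exchange being an instance of discrepancy. *)
Lemma dense_counting (V : J -> finType) (eps : R) H (g g' : {set J} -> VJ V -> R) :
  antichain H ->
  (forall e, e \in H -> depends_on e (g e) /\ depends_on e (g' e)) ->
  (forall e, e \in H -> forall x, 0 <= g e x <= 1) ->
  (forall e, e \in H -> forall x, 0 <= g' e x <= 1) ->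
  (forall e, e \in H -> low_discrepancy eps e (fun x => g e x - g' e x)) ->
  `|expect (fun x => \prod_(e in H) g e x) - expect (fun x => \prod_(e in H) g' e x)|
    <= #|H|%:R * eps.
Proof.
move=> anti dep g01 g'01 low.
pose hyb (T : {set {set J}}) e := if e \in T then g' e else g e.
suff main n (T : {set {set J}}) : T \subset H -> #|T| = n ->
    `|expect (fun x => \prod_(e in H) g e x) -
      expect (fun x => \prod_(e in H) hyb T e x)| <= n%:R * eps.
  have := main _ H (subxx _) erefl.
  congr (`|_ - _| <= _); apply: eq_expect => x.
  by apply: eq_bigr => e eH; rewrite /hyb eH.
elim: n T => [|n IHn] T TH cT.
  have -> : T = set0 by apply: cards0_eq.
  rewrite mul0r (_ : _ - _ = 0) ?normr0//; apply/eqP; rewrite subr_eq0; apply/eqP.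
  by apply: eq_expect => x; apply: eq_bigr => e _; rewrite /hyb inE.
have /card_gt0P [e eT] : (0 < #|T|)%N by rewrite cT.
have eH := subsetP TH e eT.
have cT' : #|T :\ e| = n by move: cT; rewrite (cardsD1 e) eT => -[].
have IH := IHn _ (subset_trans (subD1set _ _) TH) cT'.
have step : `|expect (fun x => \prod_(f in H) hyb (T :\ e) f x) -
    expect (fun x => \prod_(f in H) hyb T f x)| <= eps.
  rewrite -expectB.
  have := low e eH (H :\ e) (hyb T).
  have -> : expect (fun x => (g e x - g' e x) * \prod_(f in H :\ e) hyb T f x) =
      expect (fun x => \prod_(f in H) hyb (T :\ e) f x - \prod_(f in H) hyb T f x).
    apply: eq_expect => x; rewrite !(big_setD1 e eH) /= mulrBl; congr (_ - _).
      rewrite {2}/hyb !inE eqxx /=; congr (_ * _); apply: eq_bigr => f.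
      by rewrite /hyb !inE => /andP[-> _].
    by congr (_ * _); rewrite /hyb eT.
  apply=> f; rewrite !inE => /andP[fe fH]; first by rewrite anti// eq_sym.
    by have [] := dep f fH; rewrite /hyb; case: ifP.
  by move=> x; rewrite /hyb; case: ifP => _; [apply: g'01|apply: g01].
rewrite -[n.+1]addn1 natrD mulrDl mul1r (le_trans _ (lerD IH step))//.
by rewrite (le_trans _ (ler_normD _ _))// addrA subrK.
Qed.

(** The pointwise inequality behind the truncation of the averaged function [p]
    at [1]: where [p] exceeds [1], so does its majorant [m]. *)
Lemma truncation_bound (c p q m : R) : 0 < c ->
  0 <= p <= m -> 0 <= q <= 1 ->
  (p - q) ^+ 2 <= (1 + c^-1 / 2) * (m - 1) ^+ 2 + c / 2
                  + Num.min p 1 * (p - q) - q * (p - q).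
Proof.
move=> c0 /andP[p0 pm] /andP[q0 q1].
have amgm : `|m - 1| <= c^-1 / 2 * (m - 1) ^+ 2 + c / 2.
  have : 0 <= c^-1 * (`|m - 1| - c) ^+ 2.
    by rewrite mulr_ge0 ?sqr_ge0// invr_ge0 ltW.
  rewrite -[(m - 1) ^+ 2]real_normK ?num_real//; move: `|m - 1| => t.
  have -> : c^-1 * (t - c) ^+ 2 = c^-1 * t ^+ 2 - (c^-1 * c) * (2 * t) + (c^-1 * c) * c.
    by ring.
  by rewrite mulVf ?gt_eqF//; lra.
have [p1|p1] := leP p 1.
  have : 0 <= (m - 1) ^+ 2 by apply: sqr_ge0.
  have : 0 <= `|m - 1| by []; rewrite mulrDl mul1r.
  nra.
have : m - 1 <= `|m - 1| by apply: ler_norm.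
rewrite mulrDl mul1r; nra.
Qed.

(** One step of densification.  Averaging over the coordinates outside [e1]
    replaces the product over the other edges by [p := cond_expect e1 G].  The
    weight [nu e1] may be dropped in the second moment of [p - q], where [q] is
    the average of the other product.  In that second moment [p] may be truncated
    at [1], and then it is controlled by the counting lemma with a function
    bounded by [1] at the edge [e1], the same on both sides. *)
Lemma densification (V : J -> finType) (x0 : VJ V) (c eps delta : R) H e1
    (nu g g' : {set J} -> VJ V -> R) :
  0 < c -> 0 <= delta <= 1 -> 3 * delta <= c -> 3 * delta <= c ^+ 2 ->
  (forall m, (m <= #|J|)%N -> forall t, 0 <= t ->
     (t / 2) ^+ (2 ^ m) <= 2 ^+ (2 ^ m) * delta / 2 -> t <= c) ->
  antichain H -> e1 \in H ->
  (forall e, e \in H ->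
     [/\ depends_on e (nu e), depends_on e (g e) & depends_on e (g' e)]) ->
  linear_forms_within delta H nu ->
  (forall e, e \in H -> forall x, 0 <= g e x <= nu e x) ->
  (forall e, e \in H -> forall x, 0 <= g' e x <= 1) ->
  low_discrepancy eps e1 (fun x => g e1 x - g' e1 x) ->
  (forall u, depends_on e1 u -> (forall x, 0 <= u x <= 1) ->
    `|expect (fun x => u x * \prod_(e in H :\ e1) g e x) -
      expect (fun x => u x * \prod_(e in H :\ e1) g' e x)| <= c) ->
  `|expect (fun x => \prod_(e in H) g e x) - expect (fun x => \prod_(e in H) g' e x)|
    <= Num.sqrt (16 * c) + eps.
Proof.
move=> c0 /andP[d0 d1] dc dc2 slfP anti e1H dep lf gnu g'1 low ind.
have inH e : e \in H :\ e1 -> e \in H by rewrite inE => /andP[].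
have anti1 e : e \in H :\ e1 -> ~~ (e \subset e1) && ~~ (e1 \subset e).
  by rewrite !inE => /andP[ne eH]; rewrite !anti// eq_sym.
have nu_dep e : e \in H -> depends_on e (nu e) by case/dep.
pose G x := \prod_(e in H :\ e1) g e x.
pose G' x := \prod_(e in H :\ e1) g' e x.
pose M x := \prod_(e in H :\ e1) nu e x.
pose p := cond_expect e1 G; pose q := cond_expect e1 G'; pose m := cond_expect e1 M.
pose d x := p x - q x.
have [nu1_dep g1_dep g'1_dep] := dep _ e1H.
have p_dep : depends_on e1 p by apply: depends_on_cond.
have q_dep : depends_on e1 q by apply: depends_on_cond.
have p_bd x : 0 <= p x <= m x.
  rewrite cond_expect_ge0 => [|y]; last first.
    by apply: prodr_ge0 => e /inH /gnu/(_ y)/andP[].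
  by apply: ler_cond_expect => y; apply: ler_prod => e /inH eH; apply: gnu.
have q_bd x : 0 <= q x <= 1.
  rewrite cond_expect_ge0 => [|y]; last first.
    by apply: prodr_ge0 => e /inH /g'1/(_ y)/andP[].
  rewrite -[leRHS](expect_cst x0); apply: ler_expect => y.
  by apply: prodr_ile1 => e /inH eH; apply: g'1.
have moment (al be : bool) :
  `|expect (fun x => expect (fun y =>
     \prod_(e in H :\ e1) (nu e x ^+ al * nu e (mix e1 y x) ^+ be))) - 1| <= delta.
  have FP e : e \in H :\ e1 -> (e \in H) && ~~ (e \subset e1).
    by move=> eE; rewrite inH//; have /andP[->] := anti1 e eE.
  have := majorant_averageP lf nu_dep al be (sub0set e1) FP.
  congr (`|_ - _| <= _); apply: eq_expect => x; apply: eq_expect => y.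
  apply: eq_bigr => e _; rewrite (big_pred1 set0) => [|w]; last by rewrite set0I subset0.
  by rewrite mix_set0.
have m2 : expect (fun x => (m x - 1) ^+ 2) <= 3 * delta.
  have Em : `|expect m - 1| <= delta.
    have -> : expect m = expect M.
      transitivity (expect (fun x => 1 * m x)).
        by apply: eq_expect => x; rewrite mul1r.
      by rewrite expect_cond//; apply: eq_expect => x; rewrite mul1r.
    have := moment true false; congr (`|_ - _| <= _); apply: eq_expect => x.
    rewrite -[RHS](expect_cst x0); apply: eq_expect => y; apply: eq_bigr => e _.
    by rewrite expr1 expr0 mulr1.
  have Em2 : `|expect (fun x => 1 * (m x * m x)) - 1| <= delta.
    rewrite expect_cond2//; have := moment true true; congr (`|_ - _| <= _).
    apply: eq_expect => x; apply: eq_expect => y; rewrite mul1r -big_split.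
    by apply: eq_bigr => e _; rewrite !expr1.
  have -> : expect (fun x => (m x - 1) ^+ 2) =
      expect (fun x => 1 * (m x * m x)) - 2 * expect m + expect (fun _ : VJ V => 1).
    by rewrite -expectZ -expectB -expectD; apply: eq_expect => x; ring.
  rewrite (expect_cst x0).
  by move: Em Em2; rewrite !ler_norml => /andP[? ?] /andP[? ?]; lra.
have dense u : depends_on e1 u -> (forall x, 0 <= u x <= 1) ->
    `|expect (fun x => u x * d x)| <= c.
  move=> u_dep u01; have := ind u u_dep u01.
  rewrite -[expect (fun x => u x * \prod_(e in _) g e x)](expect_cond _ u_dep).
  rewrite -[expect (fun x => u x * \prod_(e in _) g' e x)](expect_cond _ u_dep).
  by rewrite -expectB; congr (`|_| <= _); apply: eq_expect => x; rewrite -mulrBr.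
have Ed2 : expect (fun x => d x ^+ 2) <= 4 * c.
  have min_dep : depends_on e1 (fun x => Num.min (p x) 1).
    by move=> x y xy; rewrite (p_dep x y xy).
  have min01 x : 0 <= Num.min (p x) 1 <= 1.
    by have /andP[p0 _] := p_bd x; rewrite le_min p0 ler01 ge_min lexx orbT.
  have := dense _ min_dep min01; have := dense _ q_dep q_bd.
  set Eq := expect _; set Emin := expect _ => Eq_le Emin_le.
  have : expect (fun x => d x ^+ 2) <=
      (1 + c^-1 / 2) * expect (fun x => (m x - 1) ^+ 2) + c / 2 + Emin - Eq.
    rewrite -[c / 2](expect_cst x0) /Emin /Eq -expectZ -!expectD -expectB.
    by apply: ler_expect => x; apply: truncation_bound.
  move/le_trans; apply.
  have Ec : c^-1 * expect (fun x => (m x - 1) ^+ 2) <= c.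
    by rewrite mulrC ler_pdivrMr// -expr2 (le_trans m2).
  by move: Eq_le Emin_le; rewrite !ler_norml => /andP[? ?] /andP[? ?]; lra.
have slf (al be : bool) (a b : {set J} -> VJ V -> R) :
    (forall e, e \in H -> depends_on e (a e) /\ depends_on e (b e)) ->
    (forall e, e \in H -> forall x, 0 <= a e x <= nu e x ^+ al) ->
    (forall e, e \in H -> forall x, 0 <= b e x <= nu e x ^+ be) ->
    `|expect (fun x => (nu e1 x - 1) *
        (cond_expect e1 (fun x => \prod_(e in H :\ e1) a e x) x *
         cond_expect e1 (fun x => \prod_(e in H :\ e1) b e x) x))| <= c.
  move=> ab_dep a_bd b_bd; rewrite expect_cond2; last first.
    by move=> x y xy; rewrite (nu1_dep x y xy).
  apply: (slfP #|e1|) => //; first exact: max_card.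
  by apply: (strong_linear_forms lf nu_dep (al := al) (be := be)) => // e /inH eH;
    [apply: ab_dep|apply: a_bd|apply: b_bd].
have Enud2 : expect (fun x => nu e1 x * d x ^+ 2) <= 8 * c.
  have g_dep e (eH : e \in H) : depends_on e (g e) by case: (dep e eH).
  have g'_dep e (eH : e \in H) : depends_on e (g' e) by case: (dep e eH).
  have pp := slf true true g g _ gnu gnu.
  have pq := slf true false g g' _ gnu g'1.
  have qq := slf false false g' g' _ g'1 g'1.
  have -> : expect (fun x => nu e1 x * d x ^+ 2) = expect (fun x => d x ^+ 2) +
      (expect (fun x => (nu e1 x - 1) * (p x * p x)) -
       2 * expect (fun x => (nu e1 x - 1) * (p x * q x)) +
       expect (fun x => (nu e1 x - 1) * (q x * q x))).
    rewrite -expectZ -expectB -!expectD; apply: eq_expect => x; rewrite /d; ring.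
  have {}pp : `|expect (fun x => (nu e1 x - 1) * (p x * p x))| <= c.
    by apply: pp => e eH; split; apply: g_dep.
  have {}pq : `|expect (fun x => (nu e1 x - 1) * (p x * q x))| <= c.
    by apply: pq => e eH; split; [apply: g_dep|apply: g'_dep].
  have {}qq : `|expect (fun x => (nu e1 x - 1) * (q x * q x))| <= c.
    by apply: qq => e eH; split; apply: g'_dep.
  move: pp pq qq; rewrite !ler_norml => /andP[? ?] /andP[? ?] /andP[? ?]; lra.
have Enu : expect (nu e1) <= 2.
  have := lf [set (e1, set0)].
  rewrite /linear_form_on.
  under eq_expect do under eq_expect do rewrite big_set1 mix_set0.
  under eq_expect do rewrite (expect_cst x0).
  move=> /(_ _)/ler_normlP[|_]; last by lra.
  by move=> e; rewrite inE => /eqP ->; rewrite e1H sub0set.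
have nu0 x : 0 <= nu e1 x by have /andP[g0 gn] := gnu _ e1H x; apply: le_trans gn.
have -> :
    expect (fun x => \prod_(e in H) g e x) - expect (fun x => \prod_(e in H) g' e x) =
    expect (fun x => g e1 x * d x) + expect (fun x => (g e1 x - g' e1 x) * G' x).
  have split (h : {set J} -> VJ V -> R) : expect (fun x => \prod_(e in H) h e x) =
      expect (fun x => h e1 x * \prod_(e in H :\ e1) h e x).
    by apply: eq_expect => x; rewrite (big_setD1 e1 e1H).
  rewrite !split -[expect (fun x => g e1 x * _)](expect_cond _ g1_dep).
  have -> : expect (fun x => (g e1 x - g' e1 x) * G' x) =
      expect (fun x => g e1 x * q x) - expect (fun x => g' e1 x * G' x).
    by rewrite expect_cond// -expectB; apply: eq_expect => x; rewrite mulrBl.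
  rewrite addrA -expectD; congr (_ - _); apply: eq_expect => x.
  by rewrite /d mulrBr subrK.
rewrite (le_trans (ler_normD _ _))// lerD//; last first.
  apply: low => e eE; first by have /andP[] := anti1 e eE.
    by case: (dep e (inH e eE)).
  exact: g'1 (inH e eE).
rewrite -sqrtr_sqr; apply: ler_wsqrtr; rewrite -[leLHS]real_normK ?num_real//.
have le_nu : `|expect (fun x => g e1 x * d x)| <= expect (fun x => nu e1 x * `|d x|).
  rewrite (le_trans (ler_norm_expect _))//; apply: ler_expect => x.
  have /andP[g0 gn] := gnu _ e1H x.
  by rewrite normrM ger0_norm// ler_wpM2r.
rewrite (le_trans (_ : _ <= expect (fun x => nu e1 x * `|d x|) ^+ 2))//.
  by rewrite lerXn2r ?nnegrE// (le_trans _ le_nu).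
rewrite (le_trans (cauchy_schwarz_expect _ nu0))//.
under [X in _ * X]eq_expect do rewrite real_normK ?num_real//.
have -> : 16 * c = 2 * (8 * c) by ring.
by rewrite ler_pM// expect_ge0// => x; rewrite mulr_ge0 ?sqr_ge0.
Qed.

End Counting.

Section CountingLemma.
Variables (R : realType) (J : finType).
Implicit Types (e w : {set J}) (H S : {set {set J}}).

(** The threshold for the error of the linear forms below which the bound of
    [strong_linear_forms] is at most [c], uniformly in the size [m] of the edge. *)
Lemma power_threshold (n : nat) (c : R) : 0 < c ->
  exists2 delta0 : R, 0 < delta0 & forall delta, 0 <= delta <= delta0 ->
    forall m, (m <= n)%N -> forall t, 0 <= t ->
    (t / 2) ^+ (2 ^ m) <= 2 ^+ (2 ^ m) * delta / 2 -> t <= c.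
Proof.
move=> c0; pose s := Num.min (c / 2) 1; pose N := (2 ^ n)%N.
have s0 : 0 < s by rewrite lt_min ltr01 divr_gt0.
have s1 : s <= 1 by rewrite ge_min lexx orbT.
have sc : s <= c / 2 by rewrite ge_min lexx.
exists (s ^+ N / 2 ^+ N) => [|delta /andP[d0 dle] m mn t t0 le_t].
  by rewrite divr_gt0// exprn_gt0.
have mN : (2 ^ m <= N)%N by rewrite leq_exp2l.
rewrite leNgt; apply/negP => ct.
have lt1 : s ^+ (2 ^ m) < (t / 2) ^+ (2 ^ m).
  rewrite ltr_pXn2r ?expn_gt0// ?nnegrE ?divr_ge0// ?(ltW s0)//.
  by rewrite (le_lt_trans sc)// ltr_pM2r// invr_gt0.
have le2 : s ^+ N <= s ^+ (2 ^ m) by rewrite ler_wiXn2l// ltW.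
have le3 : 2 ^+ (2 ^ m) * delta <= s ^+ N.
  rewrite (le_trans (_ : _ <= 2 ^+ N * delta))//.
    by rewrite ler_wpM2r// ler_weXn2l// ler1n.
  by rewrite mulrC -ler_pdivlMr// exprn_gt0.
have := exprn_gt0 N s0; lra.
Qed.

(** The induction is on the number of edges in [S], that is, of edges whose
    weight is allowed to differ from [1].  The same [eps] bounds the discrepancy
    and the error in the linear forms condition. *)
Lemma relative_counting (k : nat) (gamma : R) : 0 < gamma ->
  exists2 eps : R, 0 < eps &
  forall (V : J -> finType) (x0 : VJ V) H S (nu g g' : {set J} -> VJ V -> R),
    (#|S| <= k)%N -> S \subset H -> antichain H ->
    (forall e, e \in H -> e \notin S -> forall x, nu e x = 1) ->
    (forall e, e \in H ->
       [/\ depends_on e (nu e), depends_on e (g e) & depends_on e (g' e)]) ->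
    linear_forms_within eps H nu ->
    (forall e, e \in H -> forall x, 0 <= g e x <= nu e x) ->
    (forall e, e \in H -> forall x, 0 <= g' e x <= 1) ->
    (forall e, e \in H -> low_discrepancy eps e (fun x => g e x - g' e x)) ->
  `|expect (fun x => \prod_(e in H) g e x) -
    expect (fun x => \prod_(e in H) g' e x)| <= gamma.
Proof.
elim: k gamma => [|k IHk] gamma gamma0.
  have n0 : 0 < #|{set J}|%:R :> R.
    by rewrite ltr0n; apply/card_gt0P; exists set0.
  exists (gamma / #|{set J}|%:R); first by rewrite divr_gt0.
  move=> V x0 H S nu g g' cS SH anti nu1 dep _ gnu g'1 low.
  have S0 : S = set0 by apply/eqP; rewrite -cards_eq0 -leqn0.
  rewrite (le_trans (dense_counting anti _ _ g'1 low))//.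
  - by move=> e /dep[].
  - by move=> e eH x; have := gnu e eH x; rewrite nu1// S0 inE.
  - rewrite mulrCA ler_piMr ?(ltW gamma0)// ler_pdivrMr// mul1r ler_nat max_card//.
(* With this [c], the error [sqrt (16 c)] of one densification step is [gamma / 2]. *)
pose c := gamma ^+ 2 / 64.
have c0 : 0 < c by rewrite divr_gt0 ?exprn_gt0.
have [eps1 eps1_gt0 P1] := IHk _ gamma0.
have [eps2 eps2_gt0 P2] := IHk _ c0.
have [eps3 eps3_gt0 P3] := power_threshold #|J| c0.
pose eps := \big[Num.min/1]_(x <- [:: eps1; eps2; eps3; c / 3; c ^+ 2 / 3; gamma / 2]) x.
have eps_le x : x \in [:: eps1; eps2; eps3; c / 3; c ^+ 2 / 3; gamma / 2] -> eps <= x.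
  by move=> xin; apply: (@ge_bigmin_seq _ _ _ _ _ x predT id).
have eps_le1 : eps <= 1 by apply: bigmin_le_id.
have eps_gt0 : 0 < eps.
  rewrite /eps big_seq; apply: lt_bigmin => // x.
  by rewrite !inE => /or4P[/eqP->|/eqP->|/eqP->|/or3P[]/eqP->] //;
    rewrite divr_gt0// exprn_gt0.
have le_eps1 : eps <= eps1 by rewrite eps_le// !inE eqxx ?orbT.
have le_eps2 : eps <= eps2 by rewrite eps_le// !inE eqxx ?orbT.
have le_eps3 : eps <= eps3 by rewrite eps_le// !inE eqxx ?orbT.
have le_c : eps <= c / 3 by rewrite eps_le// !inE eqxx ?orbT.
have le_c2 : eps <= c ^+ 2 / 3 by rewrite eps_le// !inE eqxx ?orbT.
have le_gamma : eps <= gamma / 2 by rewrite eps_le// !inE eqxx ?orbT.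
exists eps => // V x0 H S nu g g' cS SH anti nu1 dep lf gnu g'1 low.
have [cSk|cSk] := leqP #|S| k.
  apply: (P1 V x0 H S nu) => //; first exact: linear_forms_withinW lf.
  by move=> e /low; apply: low_discrepancyW.
have /card_gt0P [e1 e1S] : (0 < #|S|)%N by apply: leq_trans cSk.
have e1H := subsetP SH _ e1S.
have le_sum : Num.sqrt (16 * c) + eps <= gamma.
  have -> : 16 * c = (gamma / 2) ^+ 2 by rewrite /c; field.
  by rewrite sqrtr_sqr ger0_norm ?divr_ge0 ?(ltW gamma0)//; lra.
apply: le_trans le_sum.
apply: (@densification _ _ V x0 c eps eps H e1 nu) => //.
- by rewrite ltW.
- by rewrite mulrC -ler_pdivlMr.
- by rewrite mulrC -ler_pdivlMr.
- by apply: P3; rewrite ltW.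
- exact: low.
(* With [u] at the edge [e1] on both sides, the weight there becomes [1]. *)
move=> u u_dep u01.
pose at1 (v : VJ V -> R) (h : {set J} -> VJ V -> R) e := if e == e1 then v else h e.
have prod_at1 v h : expect (fun x => \prod_(e in H) at1 v h e x) =
    expect (fun x => v x * \prod_(e in H :\ e1) h e x).
  apply: eq_expect => x; rewrite (big_setD1 e1 e1H) /= {1}/at1 eqxx.
  by congr (_ * _); apply: eq_bigr => e; rewrite /at1 !inE => /andP[/negbTE ->].
rewrite -!prod_at1.
apply: (P2 V x0 H (S :\ e1) (at1 (fun=> 1) nu)) => //.
- by move: cS; rewrite (cardsD1 e1 S) e1S.
- exact: subset_trans (subD1set _ _) SH.
- by move=> e eH; rewrite /at1 !inE; case: eqP => //= _; apply: nu1.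
- by move=> e eH; rewrite /at1; case: eqP => [->|_]; [split|apply: dep].
- move=> K KP; rewrite (le_trans _ le_eps2)//.
  have := lf [set p in K | p.1 != e1]; rewrite /linear_form_on.
  have -> : expect (fun x => expect (fun y => \prod_(p in K)
        at1 (fun=> 1) nu p.1 (mix p.2 x y))) =
      expect (fun x => expect (fun y => \prod_(p in [set p in K | p.1 != e1])
        nu p.1 (mix p.2 x y))).
    apply: eq_expect => x; apply: eq_expect => y.
    rewrite [LHS](bigID (fun p => p.1 == e1)) /= big1 ?mul1r => [|p /andP[_ p1]].
      apply: eq_big => p; first by rewrite inE.
      by move=> /andP[_ /negbTE]; rewrite /at1 => ->.
    by rewrite /at1 p1.
  by apply=> p; rewrite inE => /andP[/KP].
- by move=> e eH; rewrite /at1; case: eqP => _; [apply: u01|apply: gnu].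
- by move=> e eH; rewrite /at1; case: eqP => _; [apply: u01|apply: g'1].
- move=> e eH; rewrite /at1; case: eqP => _; last first.
    by apply: low_discrepancyW le_eps2 _; apply: low.
  move=> E h _ _ _; rewrite (_ : expect _ = 0) ?normr0 ?ltW//.
  by rewrite -(expect_cst x0 0); apply: eq_expect => x; rewrite subrr mul0r.
Qed.

End CountingLemma.

Theorem theorem2p17 (R : realType) (gamma : R) (gamma_gt0 : 0 < gamma)
    (J : finType) :
  exists2 eps : R, 0 < eps &
  forall tau : nat -> R, tau @ \oo --> (0 : R) ->
  exists N0 : nat,
  forall (r : nat) (H : {set {set J}}) (V : nat -> J -> finType)
    (nu : forall N : nat, weights R (V N)),
    (1 <= r)%N ->
    (forall e : {set J}, e \in H -> #|e| = r) ->
    (forall (N : nat) (j : J), (0 < #|V N j|)%N) ->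
    (forall N : nat, weighted_hypergraph H (nu N)) ->
    linear_forms_condition H tau nu ->
  forall N : nat, (N0 <= N)%N ->
  forall g g' : weights R (V N),
    weighted_hypergraph H g -> le_weights H g (nu N) ->
    weighted_hypergraph H g' -> le_weights H g' (const_weights 1) ->
    discrepancy_pair H eps g g' ->
  `| hom_density H g - hom_density H g' | <= gamma.
Proof.
have [eps eps_gt0 counting] := relative_counting J #|{set J}| gamma_gt0.
exists eps => // tau /cvgrPdist_lt /(_ eps eps_gt0) [N0 _ tau_lt].
exists N0 => r H V nu _ Hr V0 _ lf N leN g g' g0 gnu g'0 g'1 disc.
have x0 : VJ (V N) := [ffun j => xchoose (card_gt0P (V0 N j))].
apply: (counting (V N) x0 H H (fun e x => nu N e (restrJ e x))
  (fun e x => g e (restrJ e x)) (fun e x => g' e (restrJ e x))) => //.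
- exact: max_card.
- move=> e e' eH e'H; apply: contraNN => ee'.
  by rewrite eqEcard ee' (Hr e eH) (Hr e' e'H) leqnn.
- by move=> e eH /negP.
- by move=> e _; split; apply: depends_on_restrJ.
- move=> K KP; rewrite -(linear_form_onE _ KP); apply: le_trans (lf _ N) _.
  have := tau_lt N leN; rewrite /= sub0r normrN => /ltW; apply: le_trans.
  exact: ler_norm.
- by move=> e eH x; rewrite g0 ?gnu.
- by move=> e eH x; rewrite g'0 ?g'1.
- by move=> e eH; apply: discrepancy_pair_low disc eH.
Qed.
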